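(* The function $(t,p)\mapsto\dim_*\nu_t^p$ is lower semi-continuous on $(0,1)\times(0,1)$.
   Context: For $0<t<1$ and $0<p<1$, the biased Bernoulli convolution $\nu_t^p$ is the probability measure on $\mathbb{R}$ that is the distribution of the random real number $\sum_{n=0}^\infty\pm t^n$, where the signs are chosen i.i.d. with probabilities $p$ (for $+$) and $1-p$ (for $-$). The lower Hausdorff dimension of a Borel probability measure $\nu$ is $\dim_*\nu=\inf\{\dim A:\nu(A)>0\}$, with $\dim A$ the Hausdorff dimension of the Borel set $A$. *)

(* Defs.v *)
From HB Require Import structures.
From mathcomp Require Import all_boot all_order all_algebra finmap.
From mathcomp Require Import all_classical all_reals all_analysis.

Set Implicit Arguments.
Unset Strict Implicit.
Unset Printing Implicit Defensive.

Import Order.TTheory GRing.Theory Num.Theory.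
Import numFieldNormedType.Exports.

Local Open Scope classical_set_scope.
Local Open Scope ring_scope.

(* The diameter of the empty set is -oo here; hausdorff_weight discards it. *)
Definition diameter (R : realType) (U : set R) : \bar R :=
  ereal_sup [set (`|x.1 - x.2|)%:E | x in U `*` U].

(* The case distinction only matters for s = 0, where diam(U)^0 counts the
   nonempty sets of a cover (in particular 0^0 = 1 for a singleton). *)
Definition hausdorff_weight (R : realType) (s : R) (U : set R) : \bar R :=
  if U == set0 then 0%E else poweR (diameter U) s.

Definition hausdorff_content (R : realType) (s delta : R) (A : set R) : \bar R :=
  ereal_inf [set (\sum_(0 <= i <oo) hausdorff_weight s (U i))%E |
    U in [set U : nat -> set R | A `<=` \bigcup_i U i /\
                                 forall i, (diameter (U i) <= delta%:E)%E]].

Definition hausdorff_measure (R : realType) (s : R) (A : set R) : \bar R :=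
  ereal_sup [set hausdorff_content s delta A | delta in [set d : R | 0 < d]].

Definition hausdorff_dim (R : realType) (A : set R) : \bar R :=
  ereal_inf [set s%:E | s in [set s : R | 0 <= s /\
                                          hausdorff_measure s A = 0%E]].

Definition lower_hausdorff_dim (R : realType)
    (nu : probability (measurableTypeR R) R) : \bar R :=
  ereal_inf [set hausdorff_dim A | A in [set A : set (measurableTypeR R) |
                                         measurable A /\ (0 < nu A)%E]].

Definition mutually_independent (I : choiceType) (d d' : measure_display)
    (T : measurableType d) (T' : measurableType d') (R : realType)
    (P : probability T R) (X : I -> {RV P >-> T'}) : Prop :=
  forall (J : {fset I}) (B : I -> set T'), (forall i, measurable (B i)) ->
    P (\bigcap_(i in [set` J]) (X i @^-1` B i)) =
    (\prod_(i <- J) P (X i @^-1` B i))%E.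

(* [eps n w] is [true] when the n-th sign is +, so that the n-th term
   (-1) ^+ (~~ eps n w) * t ^+ n is t^n or -t^n. *)
Definition is_biased_bernoulli_convolution (R : realType) (t p : R)
    (nu : probability (measurableTypeR R) R) : Prop :=
  exists (d : measure_display) (T : measurableType d) (P : probability T R)
         (eps : nat -> {RV P >-> bool}) (S : {RV P >-> measurableTypeR R}),
    [/\ mutually_independent eps,
        forall n, P (eps n @^-1` [set true]) = p%:E,
        forall w, series (fun n => (-1) ^+ (~~ eps n w) * t ^+ n) @ \oo --> S w &
        forall B, measurable B -> nu B = distribution P S B].

(* Main.v *)
Require Import Defs.
From HB Require Import structures.
From mathcomp Require Import all_boot all_order all_algebra finmap.
From mathcomp Require Import all_classical all_reals all_analysis.
From mathcomp Require Import ring lra zify.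

(** The idea is to find, for any number [a] below the dimension at a parameter
    [(t0, p0)], a certificate that the dimension exceeds [a] which involves only
    finitely many signs; such a certificate survives a small change of the
    parameters.

    Fix a block length [N] and put [rho = t ^ N]. The partial sum of the first
    [N * k] terms determines the random sum up to [O(rho ^ k)], so everything
    is phrased with words of signs. If the dimension at [(t0, p0)] exceeds [s],
    then for large [N] almost all words of length [N] lie in places where an
    interval of length of order [t0 ^ N] has probability at most
    [t0 ^ (N * s)]: otherwise the crowded intervals would form, at infinitely
    many scales, a limsup set of positive measure and dimension at most [s]
    ([crowded_rare]). That finitely many words are well spread out is the
    certificate; it is stable because probabilities of words and partial sums
    are Lipschitz in [p] and [t] ([good_words_stable]).

    Conversely, spreading at a single scale forces the dimension to be large.
    For a finite weighted point set [L] consider the moment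
    [E (L (ball (X, r)) ^ theta)] with a small [theta > 0]. At scale [rho] it is
    at most [A * |L| ^ theta], where [A] depends only on how spread out the words of
    one block are ([one_scale_moment]). Conditioning on the first block and
    rescaling by [1 / rho] replaces [L] by its part near the first partial
    sum, which is again a weighted point set; hence the moment at scale [rho ^ k] is at
    most [A ^ k * |L| ^ theta] ([multi_scale_moment]). Allowing arbitrary [L],
    and not only the law of the sum itself, makes this induction work without
    any loss of constants. Taking for [L] the law of the partial sum, the
    Markov inequality, the Borel-Cantelli lemma and the mass distribution
    principle turn a bound [A <= rho ^ (theta * s')] into the lower bound [s'] on
    the dimension ([hausdorff_dim_lower]).

    Finally, as [theta] tends to [0], [A] equals [1 - theta * s * log (1 / rho)]
    up to errors which are small once [N] is large, so that [s'] can be chosen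
    as close to [s] as desired ([block_parameters], [small_exponent]). *)

Set Implicit Arguments.
Unset Strict Implicit.
Unset Printing Implicit Defensive.

Import Order.TTheory GRing.Theory Num.Theory.
Import numFieldNormedType.Exports.

Local Open Scope classical_set_scope.
Local Open Scope ring_scope.

(** * Words of signs and their partial sums *)

Section Words.
Variable R : realType.
Implicit Types (p t c : R) (n : nat) (f g : seq bool -> R).

(** Expectation of [f] over words of [n] independent signs, [true] having
    probability [p]. The recursion on the first sign makes self-similarity
    available by computation. *)
Fixpoint word_mean p n f : R :=
  if n is n'.+1 then
    p * word_mean p n' (fun w => f (true :: w)) +
    (1 - p) * word_mean p n' (fun w => f (false :: w))
  else f [::].

Lemma eq_word_mean p n f g : (forall w, size w = n -> f w = g w) ->
  word_mean p n f = word_mean p n g.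
Proof.
elim: n f g => [|n IH] f g fg /=; first exact: fg.
by congr (_ * _ + _ * _); apply: IH => w sw; apply: fg; rewrite /= sw.
Qed.

Lemma le_word_mean p n f g : 0 <= p <= 1 ->
  (forall w, size w = n -> f w <= g w) -> word_mean p n f <= word_mean p n g.
Proof.
move=> /andP[p0 p1]; elim: n f g => [|n IH] f g fg /=; first exact: fg.
by apply: lerD; apply: ler_wpM2l; rewrite ?subr_ge0//; apply: IH => w sw;
  apply: fg; rewrite /= sw.
Qed.

Lemma word_mean_cst p n (a : R) : word_mean p n (fun=> a) = a.
Proof. by elim: n => //= n ->; ring. Qed.

Lemma word_meanD p n f g : word_mean p n (fun w => f w + g w) = word_mean p n f + word_mean p n g.
Proof. by elim: n f g => //= n IH f g; rewrite !IH; ring. Qed.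

Lemma word_meanZ p n (a : R) f : word_mean p n (fun w => a * f w) = a * word_mean p n f.
Proof. by elim: n f => //= n IH f; rewrite !IH; ring. Qed.

Lemma word_mean_sum p n (I : Type) (r : seq I) (F : I -> seq bool -> R) :
  word_mean p n (fun w => \sum_(i <- r) F i w) = \sum_(i <- r) word_mean p n (F i).
Proof.
elim: r => [|i r IH].
  by rewrite big_nil -[RHS](word_mean_cst p n); apply: eq_word_mean => w _; rewrite big_nil.
rewrite big_cons -IH -word_meanD; apply: eq_word_mean => w _; exact: big_cons.
Qed.

Lemma word_mean_ge0 p n f : 0 <= p <= 1 -> (forall w, size w = n -> 0 <= f w) ->
  0 <= word_mean p n f.
Proof. by move=> p01 f0; rewrite -(word_mean_cst p n 0); exact: le_word_mean. Qed.

Lemma word_mean_le1 p n f : 0 <= p <= 1 -> (forall w, size w = n -> f w <= 1) ->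
  word_mean p n f <= 1.
Proof. by move=> p01 f1; rewrite -(word_mean_cst p n 1); exact: le_word_mean. Qed.

Lemma word_mean_cat p m n f :
  word_mean p (m + n) f = word_mean p m (fun u => word_mean p n (fun v => f (u ++ v))).
Proof. by elim: m f => //= m IH f; rewrite !IH. Qed.

(** Stability in [p], uniformly in the test function; this is what makes the
    certificate at one scale an open condition. *)
Lemma word_mean_lip p q n f : 0 <= p <= 1 -> 0 <= q <= 1 ->
  (forall w, 0 <= f w <= 1) ->
  `|word_mean p n f - word_mean q n f| <= n%:R * `|p - q|.
Proof.
move=> p01 q01; elim: n f => [|n IH] f f01 /=; first by rewrite subrr normr0 mul0r.
set a := word_mean p n _; set b := word_mean p n _.
set a' := word_mean q n _; set b' := word_mean q n _.
have aa : `|a - a'| <= n%:R * `|p - q| by exact: IH.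
have bb : `|b - b'| <= n%:R * `|p - q| by exact: IH.
have a01 : 0 <= a' <= 1.
  by apply/andP; split; [apply: word_mean_ge0|apply: word_mean_le1] => // w _;
    have /andP[] := f01 (true :: w).
have b01 : 0 <= b' <= 1.
  by apply/andP; split; [apply: word_mean_ge0|apply: word_mean_le1] => // w _;
    have /andP[] := f01 (false :: w).
have -> : p * a + (1 - p) * b - (q * a' + (1 - q) * b') =
  (p - q) * (a' - b') + (p * (a - a') + (1 - p) * (b - b')) by ring.
rewrite (le_trans (ler_normD _ _))// -(natr1 n) [leRHS]mulrDl mul1r [leRHS]addrC lerD//.
  by rewrite normrM ler_piMr// ler_norml; lra.
rewrite (le_trans (ler_normD _ _))// !normrM.
have /andP[p0 p1] := p01.
rewrite (ger0_norm p0) (@ger0_norm _ (1 - p)) ?subr_ge0//.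
move: aa bb; set x := `|a - a'|; set y := `|b - b'|; set z := _ * _ => xz yz.
have -> : z = p * z + (1 - p) * z by ring.
by apply: lerD; apply: ler_wpM2l; rewrite ?subr_ge0.
Qed.

Fixpoint signed_sum t (w : seq bool) : R :=
  if w is b :: w' then (-1) ^+ (~~ b) + t * signed_sum t w' else 0.

Lemma signed_sum_cat t u v : signed_sum t (u ++ v) = signed_sum t u + t ^+ size u * signed_sum t v.
Proof.
elim: u => [|b u IH] /=; first by rewrite expr0 add0r mul1r.
by rewrite IH exprS; ring.
Qed.

(** Instead of the sharp bound [1 / (1 - t)], any [c] with [1 + t * c <= c] is
    allowed, so that one constant serves a whole neighbourhood of [t]. *)
Lemma signed_sum_bound t c w : 0 <= t -> 1 + t * c <= c -> 0 <= c -> `|signed_sum t w| <= c.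
Proof.
move=> t0 tc c0; elim: w => [|b w IH] /=; first by rewrite normr0.
rewrite (le_trans (ler_normD _ _))// normrX normrN normr1 expr1n normrM.
by rewrite (ger0_norm t0) (le_trans _ tc)// lerD2l ler_wpM2l.
Qed.

Lemma signed_sum_lip t t' w : 0 <= t <= 1 -> 0 <= t' <= 1 ->
  `|signed_sum t w - signed_sum t' w| <= (size w ^ 2)%:R * `|t - t'|.
Proof.
move=> t01 t'01.
have pts u : `|signed_sum t' u| <= (size u)%:R.
  elim: u => [|b u IH] /=; first by rewrite normr0.
  rewrite (le_trans (ler_normD _ _))// normrX normrN normr1 expr1n normrM.
  have /andP[t0 t1] := t'01.
  by rewrite (ger0_norm t0) -(nat1r (size u)) lerD2l (le_trans _ IH)// ler_piMl.
elim: w => [|b w IH] /=; first by rewrite subrr normr0 mul0r.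
have -> : (-1) ^+ (~~ b) + t * signed_sum t w - ((-1) ^+ (~~ b) + t' * signed_sum t' w) =
  t * (signed_sum t w - signed_sum t' w) + (t - t') * signed_sum t' w by ring.
have /andP[t0 t1] := t01.
rewrite (le_trans (ler_normD _ _))// !normrM (ger0_norm t0).
have h1 : t * `|signed_sum t w - signed_sum t' w| <= (size w ^ 2)%:R * `|t - t'|.
  by rewrite (le_trans _ IH)// ler_piMl.
have h2 : `|t - t'| * `|signed_sum t' w| <= (size w)%:R * `|t - t'|.
  by rewrite mulrC ler_wpM2r.
rewrite (le_trans (lerD h1 h2))// -mulrDl ler_wpM2r// -natrD ler_nat; nia.
Qed.

Lemma expr_lip t t' n : 0 <= t <= 1 -> 0 <= t' <= 1 ->
  `|t ^+ n - t' ^+ n| <= n%:R * `|t - t'|.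
Proof.
move=> /andP[t0 t1] /andP[t0' t1']; elim: n => [|n IH].
  by rewrite !expr0 subrr normr0 mul0r.
have -> : t ^+ n.+1 - t' ^+ n.+1 = t * (t ^+ n - t' ^+ n) + (t - t') * t' ^+ n.
  by rewrite !exprS; ring.
rewrite (le_trans (ler_normD _ _))// !normrM (ger0_norm t0) -(natr1 n) [leRHS]mulrDl mul1r.
apply: lerD; first by rewrite (le_trans _ IH)// ler_piMl.
by rewrite ler_piMr// ger0_norm ?exprn_ge0// exprn_ile1.
Qed.

(** The law of a word is a finite weighted point set, hence the moment bounds
    below, valid for all such sets, apply to it. *)
Lemma word_mean_list p n : 0 <= p <= 1 -> exists L : seq (R * seq bool),
  (forall x, x \in L -> 0 <= x.1) /\
  (forall f, word_mean p n f = \sum_(x <- L) x.1 * f x.2).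
Proof.
move=> /andP[p0 p1]; elim: n => [|n [L [L0 LE]]].
  exists [:: (1, [::])]; split; first by move=> x; rewrite inE => /eqP ->.
  by move=> f; rewrite big_seq1 mul1r.
exists ([seq (p * x.1, true :: x.2) | x <- L] ++
        [seq ((1 - p) * x.1, false :: x.2) | x <- L]); split.
  move=> x; rewrite mem_cat => /orP[] /mapP[y yL ->] /=;
  by rewrite mulr_ge0 ?subr_ge0// L0.
move=> f /=; rewrite !LE big_cat /= !big_map !big_distrr /=.
by congr (_ + _); apply: eq_bigr => x _; rewrite mulrA.
Qed.

End Words.

(** * Moments of finite weighted point sets *)

Section Moments.
Variable R : realType.
Implicit Types (p t c r z theta eta eps : R) (n : nat) (L : seq (R * R)).

(** Concavity of the power, in the form of two tangent inequalities of the
    exponential at [theta * ln y]. *)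
Lemma powR_le1D theta y : 0 <= theta <= 1 -> 0 <= y ->
  y `^ theta <= 1 + theta * y.
Proof.
move=> /andP[th0 th1]; rewrite le_eqVlt => /predU1P[<-|y0].
  rewrite mulr0 addr0; case: (eqVneq theta 0) => [->|th]; first by rewrite powRr0.
  by rewrite powR0.
set l := ln y.
have yE : y = expR l by rewrite lnK.
have -> : y `^ theta = expR (theta * l) by rewrite /powR gt_eqF.
set v := expR (theta * l).
have v0 : 0 <= v by exact: expR_ge0.
have e1 : v * (1 - theta * l) <= 1.
  have h : v * expR (- (theta * l)) = 1 by rewrite /v expRN mulfV// gt_eqF// expR_gt0.
  by rewrite -[leRHS]h ler_wpM2l// (le_trans _ (expR_ge1Dx _)).
have e2 : v * (1 + (1 - theta) * l) <= y.
  rewrite yE (_ : l = theta * l + (1 - theta) * l); last by ring.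
  rewrite [leRHS]expRD -(_ : l = theta * l + (1 - theta) * l); last by ring.
  by rewrite ler_wpM2l// expR_ge1Dx.
have e3 := ler_wpM2l th0 e2.
have e4 : (1 - theta) * (v * (1 - theta * l)) <= (1 - theta) * 1.
  by rewrite ler_wpM2l// subr_ge0.
have -> : v = (1 - theta) * (v * (1 - theta * l)) +
              theta * (v * (1 + (1 - theta) * l)) by ring.
lra.
Qed.

Definition mass L z r : R := \sum_(x <- L) x.1 * (`|z - x.2| <= r)%R%:R.

Definition nonneg_weights L := forall x, x \in L -> 0 <= x.1.

Definition total L : R := \sum_(x <- L) x.1.

Lemma mass_ge0 L z r : nonneg_weights L -> 0 <= mass L z r.
Proof. by move=> L0; rewrite /mass big_seq sumr_ge0// => x /L0 x0; rewrite mulr_ge0. Qed.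

Lemma total_ge0 L : nonneg_weights L -> 0 <= total L.
Proof. by move=> L0; rewrite /total big_seq sumr_ge0. Qed.

Lemma mass_le_total L z r : nonneg_weights L -> mass L z r <= total L.
Proof.
move=> L0; rewrite /mass /total [leLHS]big_seq [leRHS]big_seq.
by apply: ler_sum => x /L0 x0; rewrite ler_piMr// lern1 leq_b1.
Qed.

(** On the well spread words [G] the mass seen by [z w] averages to at most
    [eta * total L], by exchanging the two sums and using the hypothesis at each
    point of [L]; concavity of the power passes to exponent [theta]. On the
    other words the mass is at most [total L]. The resulting bound increases
    with the probability of the bad words because [eta <= 1]. *)
Lemma one_scale_moment p n (z : seq bool -> R) (G : pred (seq bool)) r
    theta eta eps : 0 <= p <= 1 ->
  0 < theta <= 1 -> 0 < eta <= 1 ->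
  (forall y, word_mean p n (fun w => (G w && (`|z w - y| <= r)%R)%:R) <= eta) ->
  word_mean p n (fun w => (~~ G w)%:R) <= eps ->
  forall L, nonneg_weights L ->
  word_mean p n (fun w => mass L (z w) r `^ theta) <=
  total L `^ theta * (eta `^ theta * (1 - eps + theta) + eps).
Proof.
move=> p01 /andP[th0 th1] /andP[eta0 eta1] HG HB L L0.
have [tot0|tot0] := eqVneq (total L) 0.
  rewrite [total L]tot0 powR0 ?gt_eqF// mul0r -(word_mean_cst p n 0).
  apply: le_word_mean => // w _.
  have := mass_le_total (z w) r L0; rewrite tot0 => m0.
  have -> : mass L (z w) r = 0 by apply/le_anti; rewrite m0 mass_ge0.
  by rewrite powR0 ?gt_eqF.
have tau0 : 0 < total L by rewrite lt0r tot0 total_ge0.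
set tau := total L in tau0 *.
set e := word_mean p n (fun w => (~~ G w)%:R) in HB.
have Ge : word_mean p n (fun w => (G w)%:R) = 1 - e.
  apply: (@addIr _ e); rewrite subrK -word_meanD -[RHS](word_mean_cst p n).
  by apply: eq_word_mean => w _; case: (G w); rewrite /= ?addr0 ?add0r.
have Gm : word_mean p n (fun w => (G w)%:R * mass L (z w) r) <= tau * eta.
  have -> : word_mean p n (fun w => (G w)%:R * mass L (z w) r) =
      \sum_(x <- L) x.1 * word_mean p n (fun w => (G w && (`|z w - x.2| <= r)%R)%:R).
    under eq_bigr do rewrite -word_meanZ.
    rewrite -word_mean_sum; apply: eq_word_mean => w _.
    rewrite big_distrr /=; apply: eq_bigr => x _.
    by case: (G w); rewrite /= ?mul1r ?mul0r ?mulr0.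
  rewrite /tau /total big_distrl /= [leLHS]big_seq [leRHS]big_seq.
  by apply: ler_sum => x /L0 x0; rewrite ler_wpM2l.
have te0 : 0 < tau * eta by rewrite mulr_gt0.
set k := theta / (tau * eta).
have k0 : 0 <= k by rewrite divr_ge0// ltW.
apply: (@le_trans _ _ (word_mean p n (fun w =>
    (tau * eta) `^ theta * ((G w)%:R + k * ((G w)%:R * mass L (z w) r)) +
    tau `^ theta * (~~ G w)%:R))).
  apply: le_word_mean => // w _; set m := mass L (z w) r.
  have m0 : 0 <= m by exact: mass_ge0.
  case: (G w) => /=; rewrite ?mulr0 ?mulr1 ?mul0r ?addr0 ?add0r ?mulr0 ?add0r ?mul1r.
    rewrite [m in leLHS](_ : m = tau * eta * (m / (tau * eta))); last first.
      by field; rewrite !gt_eqF.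
    have y0 : 0 <= m / (tau * eta) by rewrite divr_ge0// ltW.
    rewrite (powRM _ (ltW te0) y0) ler_wpM2l ?powR_ge0//.
    have := @powR_le1D theta _ _ y0; rewrite (ltW th0) th1 => /(_ isT) h.
    by rewrite (le_trans h)// /k mulrAC mulrA.
  apply: ge0_ler_powR; rewrite ?nnegrE// ?(ltW th0) ?(ltW tau0)//.
  exact: mass_le_total.
rewrite word_meanD !word_meanZ word_meanD word_meanZ Ge -/e.
rewrite powRM; [|exact: ltW|exact: ltW].
rewrite -mulrA -mulrDr ler_wpM2l ?powR_ge0//.
have h1 : 1 - e + k * word_mean p n (fun w => (G w)%:R * mass L (z w) r) <=
    1 - e + theta.
  rewrite lerD2l (le_trans (ler_wpM2l k0 Gm))// /k divfK ?gt_eqF//.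
have h2 : eta `^ theta <= 1.
  have -> : 1 = 1 `^ theta :> R by rewrite powR1.
  by rewrite ge0_ler_powR ?nnegrE ?(ltW th0) ?(ltW eta0).
have h3 : 0 <= eta `^ theta by exact: powR_ge0.
have := ler_wpM2l h3 h1.
have : (1 - eta `^ theta) * e <= (1 - eta `^ theta) * eps.
  by rewrite ler_wpM2l// subr_ge0.
lra.
Qed.

(** A point at distance at most [(2 c + 1) t ^ (n + k n)] of the partial sum of
    [w ++ v] lies at distance at most [(3 c + 1) t ^ n] of that of [w], since the
    tail contributes at most [c t ^ n]. The points of [L] satisfying this,
    seen from the partial sum of [w] and magnified by [t ^ - n], form
    a weighted point set to which the induction hypothesis applies; its total is
    the mass of [L] near the partial sum of [w], to which the bound for one
    block applies. *)
Lemma multi_scale_moment p t c n theta A : 0 <= p <= 1 -> 0 < t < 1 ->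
  0 <= c -> 1 + t * c <= c -> 0 < theta -> 0 <= A ->
  (forall L, nonneg_weights L ->
    word_mean p n (fun w => mass L (signed_sum t w) ((3 * c + 1) * t ^+ n) `^ theta) <=
    total L `^ theta * A) ->
  forall k L, nonneg_weights L ->
    word_mean p (k * n) (fun w => mass L (signed_sum t w) ((2 * c + 1) * t ^+ (k * n)) `^ theta)
      <= total L `^ theta * A ^+ k.
Proof.
move=> p01 /andP[t0 t1] c0 tc th0 A0 HA; elim=> [|k IH] L L0.
  rewrite mul0n expr0 !mulr1 /=.
  by rewrite ge0_ler_powR ?nnegrE ?mass_ge0 ?total_ge0 ?mass_le_total ?(ltW th0).
rewrite mulSn word_mean_cat.
pose r := (3 * c + 1) * t ^+ n.
pose L' w := [seq (x.1, (x.2 - signed_sum t w) / t ^+ n) | x <- L & `|signed_sum t w - x.2| <= r].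
have tn0 : 0 < t ^+ n by rewrite exprn_gt0.
have L'0 w : nonneg_weights (L' w).
  by move=> x /mapP[y]; rewrite mem_filter => /andP[_ /L0 y0] ->.
have L'tot w : total (L' w) = mass L (signed_sum t w) r.
  rewrite /total /mass big_map big_filter big_mkcond /=.
  by apply: eq_bigr => x _; case: ifP; rewrite ?mulr1 ?mulr0.
have step w v : size w = n ->
    mass L (signed_sum t (w ++ v)) ((2 * c + 1) * t ^+ (n + k * n)) <=
    mass (L' w) (signed_sum t v) ((2 * c + 1) * t ^+ (k * n)).
  move=> sw; rewrite /mass big_map big_filter [leRHS]big_mkcond /=.
  rewrite [leLHS]big_seq [leRHS]big_seq; apply: ler_sum => x /L0 x0.
  rewrite signed_sum_cat sw exprD.
  set q := t ^+ (k * n).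
  have q1 : q <= 1 by rewrite /q exprn_ile1// ltW.
  have q0 : 0 <= q by rewrite exprn_ge0// ltW.
  have [h|_] := boolP (_ <= (2 * c + 1) * (t ^+ n * q)); last first.
    by rewrite mulr0; case: ifP => // _; rewrite mulr_ge0.
  have hv : `|signed_sum t v| <= c by apply: signed_sum_bound => //; exact: ltW.
  have -> : `|signed_sum t w - x.2| <= r.
    have -> : signed_sum t w - x.2 = (signed_sum t w + t ^+ n * signed_sum t v - x.2) - t ^+ n * signed_sum t v.
      by ring.
    rewrite (le_trans (ler_normB _ _))// normrM (gtr0_norm tn0) /r.
    have := ler_wpM2l (ltW tn0) hv.
    have : (2 * c + 1) * (t ^+ n * q) <= (2 * c + 1) * t ^+ n.
      by rewrite ler_wpM2l ?addr_ge0 ?mulr_ge0// ler_piMr// ltW.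
    lra.
  rewrite [X in _ <= X * _]/=.
  have -> : signed_sum t v - (x.2 - signed_sum t w) / t ^+ n =
      (signed_sum t w + t ^+ n * signed_sum t v - x.2) / t ^+ n by field; rewrite gt_eqF.
  rewrite normrM normfV (gtr0_norm tn0) ler_pdivrMr//.
  by rewrite -mulrA (mulrC q) h.
apply: (@le_trans _ _ (word_mean p n (fun w => A ^+ k * mass L (signed_sum t w) r `^ theta))).
  apply: le_word_mean => // w sw.
  rewrite [leRHS]mulrC -L'tot; apply: le_trans (IH _ (L'0 w)).
  apply: le_word_mean => // v _.
  by rewrite ge0_ler_powR ?nnegrE ?mass_ge0 ?step ?(ltW th0).
rewrite word_meanZ exprSr [A ^+ k * A]mulrC mulrA [leRHS]mulrC.
by apply: ler_wpM2l; [exact: exprn_ge0|exact: HA].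
Qed.

End Moments.

(** * The signs as random variables *)

Section CoinTossing.
Context (R : realType) (t p : R) (d : measure_display) (T : measurableType d)
  (P : probability T R) (eps : nat -> {RV P >-> bool}).
Implicit Types (n : nat) (w : T) (V : pred (seq bool)).

Definition word n (w : T) : seq bool := [seq eps i w | i <- iota 0 n].

Lemma size_word n w : size (word n w) = n.
Proof. by rewrite size_map size_iota. Qed.

Lemma wordS n w : word n.+1 w = rcons (word n w) (eps n w).
Proof. by rewrite /word -addn1 iotaD add0n map_cat /= cats1. Qed.

Lemma word_add m n w : exists2 v, size v = n & word (m + n) w = word m w ++ v.
Proof.
rewrite /word iotaD add0n map_cat.
by exists [seq eps i w | i <- iota m n]; rewrite // size_map size_iota.
Qed.

Lemma measurable_sign n b : measurable (eps n @^-1` [set b]).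
Proof. exact: (measurable_funPTI (eps n)). Qed.

Lemma measurable_word n V : measurable [set w | V (word n w)].
Proof.
elim: n V => [|n IH] V.
  case: (boolP (V [::])) => V0.
  - by rewrite (_ : mkset _ = setT)//; apply/seteqP; split => w //=; rewrite /word.
  - by rewrite (_ : mkset _ = set0)//; apply/seteqP; split => w //=.
rewrite (_ : mkset _ =
  (eps n @^-1` [set true] `&` [set w | V (rcons (word n w) true)]) `|`
  (eps n @^-1` [set false] `&` [set w | V (rcons (word n w) false)])).
  by apply: measurableU; apply: measurableI;
    [exact: measurable_sign|exact: (IH (fun v => V (rcons v true)))
    |exact: measurable_sign|exact: (IH (fun v => V (rcons v false)))].
apply/seteqP; split => w /=; rewrite wordS.
  by case E: (eps n w); [left|right].
by case=> -[->].
Qed.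

Hypothesis eps_indep : mutually_independent eps.
Hypothesis eps_p : forall n, P (eps n @^-1` [set true]) = p%:E.

Let q (b : bool) : R := if b then p else 1 - p.

Lemma prob_sign n b : P (eps n @^-1` [set b]) = (q b)%:E.
Proof.
case: b => /=; first exact: eps_p.
rewrite (_ : _ @^-1` _ = ~` (eps n @^-1` [set true])).
  by rewrite probability_setC ?eps_p//; exact: measurable_sign.
by apply/seteqP; split => w /=; case: (eps n w).
Qed.

Lemma prob_word u : P [set w | word (size u) w = u] = (\prod_(b <- u) q b)%:E.
Proof.
pose B i : set bool := [set nth true u i].
pose J : {fset nat} := [fset i in iota 0 (size u)]%fset.
have JE i : (i \in J) = (i < size u)%N by rewrite !inE mem_iota add0n.
have -> : [set w | word (size u) w = u] = \bigcap_(i in [set` J]) (eps i @^-1` B i).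
  apply/seteqP; split => w /=.
    move=> wu i /=; rewrite JE /B /= => iu.
    by rewrite -[in RHS]wu (nth_map 0%N) ?size_iota// nth_iota.
  move=> wJ; apply: (@eq_from_nth _ true); first by rewrite size_word.
  move=> i; rewrite size_word => iu.
  rewrite (nth_map 0%N) ?size_iota// nth_iota// add0n.
  by have := wJ i; rewrite /= JE => /(_ iu).
rewrite eps_indep//.
rewrite (eq_bigr (fun i => (q (nth true u i))%:E)); last by move=> i _; rewrite prob_sign.
rewrite prodEFin; congr EFin.
rewrite (perm_big (iota 0 (size u))); last first.
  apply: uniq_perm; [exact: fset_uniq|exact: iota_uniq|].
  by move=> i; rewrite mem_iota add0n; exact: JE.
by rewrite [RHS](big_nth true) /index_iota subn0.
Qed.

(** Revealing the signs one at a time: conditioning on a prefix [u] is the form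
    of the statement for which induction on the number [n] of remaining signs works. *)
Lemma prob_word_prefix u n V :
  P [set w | word (size u) w = u /\ V (word (size u + n) w)] =
  (\prod_(b <- u) q b * word_mean p n (fun v => (V (u ++ v))%:R))%:E.
Proof.
elim: n u => [|n IH] u.
  rewrite addn0 /= cats0; case: (boolP (V u)) => Vu.
    rewrite mulr1 -prob_word; congr (P _).
    by apply/seteqP; split => w /= => [[]//|E]; rewrite E.
  rewrite mulr0 (_ : mkset _ = set0) ?measure0//.
  by apply/seteqP; split => w //= -[->]; rewrite (negbTE Vu).
pose F b := [set w | word (size (rcons u b)) w = rcons u b /\
                     V (word (size (rcons u b) + n) w)].
have mF b : measurable (F b).
  apply: measurableI; last exact: measurable_word.
  have := measurable_word (size (rcons u b)) (pred1 (rcons u b)).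
  by congr measurable; apply/seteqP; split => w /= /eqP.
have -> : [set w | word (size u) w = u /\ V (word (size u + n.+1) w)] =
    F true `|` F false.
  apply/seteqP; split => w /=; rewrite /F /= !size_rcons addnS addSn.
    move=> [wu Vw]; rewrite wordS wu.
    by case: (eps (size u) w); [left|right].
  by case=> -[]; rewrite wordS => /rcons_inj[-> _].
rewrite measureU//; last first.
  apply/seteqP; split => w //=; rewrite /F /= !size_rcons wordS.
  by move=> [[/rcons_inj[_ ->] _]] [/rcons_inj[_]].
have FE b := IH (rcons u b).
rewrite [X in (X + _)%E]FE [X in (_ + X)%E]FE -EFinD; congr EFin.
rewrite -!cats1 !big_cat !big_seq1 /=.
under eq_word_mean do rewrite -catA /=.
rewrite [RHS]mulrDr; congr (_ + _); rewrite -!mulrA; congr (_ * (_ * _)).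
by apply: eq_word_mean => v _; rewrite -catA.
Qed.

Lemma prob_wordE n V : P [set w | V (word n w)] = (word_mean p n (fun v => (V v)%:R))%:E.
Proof.
have := @prob_word_prefix [::] n V; rewrite big_nil mul1r add0n => <-.
by congr (P _); apply/seteqP; split => w /= => [|[]].
Qed.

Variable (S : T -> R).
Hypothesis t0 : 0 <= t.
Hypothesis cvgS :
  forall w, series (fun n => (-1) ^+ (~~ eps n w) * t ^+ n) @ \oo --> S w.

Lemma series_word n w :
  series (fun n => (-1) ^+ (~~ eps n w) * t ^+ n) n = signed_sum t (word n w).
Proof.
rewrite /series /=; elim: n => [|n IH]; first by rewrite big_nil.
rewrite wordS -cats1 signed_sum_cat size_word -IH big_nat_recr//= mulr0 addr0.
by rewrite [in RHS]mulrC.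
Qed.

(** The tail of the series is [t ^ n] times a partial sum, up to a limit. *)
Lemma dist_word c n w : 0 <= c -> 1 + t * c <= c ->
  `|S w - signed_sum t (word n w)| <= c * t ^+ n.
Proof.
move=> c0 tc.
have : (fun m => `|signed_sum t (word m w) - signed_sum t (word n w)|) @ \oo -->
    `|S w - signed_sum t (word n w)|.
  apply: cvg_norm; apply: cvgB; last exact: cvg_cst.
  by under eq_fun do rewrite -series_word; exact: cvgS.
move=> cv; rewrite -(cvg_lim _ cv)//; apply: limr_le.
  by apply/cvg_ex; eexists; exact: cv.
near=> m.
have mn : (n <= m)%N by near: m; exact: nbhs_infty_ge.
have [v sv] := word_add n (m - n) w; rewrite subnKC// => ->.
rewrite signed_sum_cat size_word addrAC subrr add0r normrM mulrC.
rewrite (ger0_norm (exprn_ge0 _ t0)) ler_wpM2r ?exprn_ge0//.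
exact: signed_sum_bound.
Unshelve. all: by end_near. Qed.

End CoinTossing.

(** * A lower bound for the dimension *)

Section Powers.
Variable R : realType.
Implicit Types a x y q s : R.

Lemma ler_powR_anti a x y : 0 < a -> a <= 1 -> x <= y -> a `^ y <= a `^ x.
Proof.
move=> a0 a1 xy; rewrite /powR gt_eqF// ler_expR.
by rewrite ler_wnM2r// ln_le0.
Qed.

Lemma powR_lt1 a x : 0 < a < 1 -> 0 < x -> a `^ x < 1.
Proof.
move=> /andP[a0 a1] x0; have h : 1 `^ x = 1 :> R by rewrite powR1.
rewrite -[ltRHS]h.
by rewrite gt0_ltr_powR ?nnegrE ?ler01 ?(ltW a0).
Qed.

Lemma powRX a s k : 0 <= a -> (a ^+ k) `^ s = (a `^ s) ^+ k.
Proof.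
move=> a0; rewrite -(powR_mulrn k a0) -(powR_mulrn k (powR_ge0 a s)).
by rewrite -[LHS]powRrM -[RHS]powRrM [k%:R * s]mulrC.
Qed.

Lemma expr_small q x : 0 <= q < 1 -> 0 < x -> exists m, q ^+ m < x.
Proof.
move=> /andP[q0 q1] x0.
have /cvg_expr/cvgr0Pnorm_lt/(_ _ x0)[m _ mP] : `|q| < 1 by rewrite ger0_norm.
by exists m; have := mP m (leqnn m); rewrite /= ger0_norm// exprn_ge0.
Qed.

Lemma nneseries_geometric_le a q : 0 <= a -> 0 <= q < 1 ->
  (\sum_(0 <= i <oo) (a * q ^+ i)%:E <= (a / (1 - q))%:E)%E.
Proof.
move=> a0 /andP[q0 q1]; apply: lime_le.
  by apply: is_cvg_nneseries => i _ _; rewrite lee_fin mulr_ge0// exprn_ge0.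
apply: nearW => n; rewrite sumEFin lee_fin.
have -> : \sum_(0 <= i < n) a * q ^+ i = series (geometric a q) n by [].
move: q0; rewrite le_eqVlt => /predU1P[<-|q0]; last first.
  by apply: geometric_le_lim => //; rewrite gtr0_norm.
rewrite subr0 divr1 /series /= big_mkord.
case: n => [|n]; first by rewrite big_ord0.
rewrite big_ord_recl expr0 mulr1 big1 ?addr0// => i _.
by rewrite /= exprS mul0r mulr0.
Qed.

End Powers.

Section LowerBound.
Context (R : realType) (t p c : R) (n : nat) (theta A s' s : R).
Hypotheses (t01 : 0 < t < 1) (p01 : 0 <= p <= 1) (c0 : 0 <= c)
  (tc : 1 + t * c <= c) (n0 : (0 < n)%N) (th0 : 0 < theta) (A0 : 0 <= A).
Let rho : R := t ^+ n.

Definition ball_prob k (x : seq bool) : R :=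
  word_mean p (n * k) (fun y => (`|signed_sum t x - signed_sum t y| <= (2 * c + 1) * rho ^+ k)%R%:R).

Hypothesis moment : forall k,
  word_mean p (n * k) (fun x => ball_prob k x `^ theta) <= A ^+ k.
Hypothesis A_le : A <= rho `^ (theta * s').
Hypothesis s0 : 0 < s.
Hypothesis ss' : s < s'.

Let b : R := rho `^ s.

(** The words around which balls of radius of order [rho ^ k] carry more mass
    than a measure of dimension [s] allows. *)
Definition heavy k (x : seq bool) : bool := b ^+ k < ball_prob k x.

Let rho01 : 0 < rho < 1.
Proof.
have /andP[t0 t1] := t01.
by rewrite /rho exprn_gt0// exprn_ilt1 ?ltW// -lt0n.
Qed.

Let b01 : 0 < b < 1.
Proof. by rewrite powR_lt1// powR_gt0//; case/andP: rho01. Qed.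

Lemma ball_prob_ge0 k x : 0 <= ball_prob k x.
Proof. exact: word_mean_ge0. Qed.

(** Markov inequality for the moment of order [theta]. *)
Lemma heavy_prob k : word_mean p (n * k) (fun x => (heavy k x)%:R) <=
  (rho `^ (theta * (s' - s))) ^+ k.
Proof.
have /andP[r0 r1] := rho01; have /andP[bb0 b1] := b01.
have bk0 : 0 < b ^+ k by rewrite exprn_gt0.
apply: (@le_trans _ _ (word_mean p (n * k)
    (fun x => ((b ^+ k) `^ theta)^-1 * ball_prob k x `^ theta))).
  apply: le_word_mean => // x _; rewrite /heavy; case: ltP => /= h; last first.
    by rewrite mulr_ge0// ?invr_ge0 powR_ge0.
  rewrite ler_pdivlMl ?powR_gt0// mulr1.
  by rewrite ge0_ler_powR ?nnegrE ?ball_prob_ge0 ?ltW.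
rewrite word_meanZ ler_pdivrMl ?powR_gt0//.
have bE : b `^ theta = rho `^ (s * theta) by rewrite /b -powRrM.
rewrite powRX ?(ltW bb0)// -exprMn bE.
rewrite -powRD; last by rewrite (gt_eqF r0) implybT.
rewrite (_ : s * theta + _ = theta * s'); last by ring.
rewrite (le_trans (moment k))// lerXn2r ?nnegrE ?powR_ge0//.
Qed.

Context (d : measure_display) (T : measurableType d)
  (P : probability T R) (eps : nat -> {RV P >-> bool})
  (S : {RV P >-> measurableTypeR R}).
Hypothesis eps_indep : mutually_independent eps.
Hypothesis eps_p : forall n, P (eps n @^-1` [set true]) = p%:E.
Hypothesis cvgS :
  forall w, series (fun n => (-1) ^+ (~~ eps n w) * t ^+ n) @ \oo --> S w.

Let Heavy k := [set w | heavy k (word eps (n * k) w)].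

Let mHeavy k : measurable (Heavy k).
Proof. exact: measurable_word. Qed.

(** If some light word has its partial sum close to [U], then all words with
    partial sum close to [U] fall in the ball around it, whose probability is
    controlled by lightness. Since [U] is arbitrary, its preimage need not be
    measurable and has to be enclosed in an event [M] on finitely many signs. *)
Lemma light_part_of_small_set (U : set R) k :
  (forall x y, U x -> U y -> `|x - y| <= rho ^+ k) ->
  exists M : set T, [/\ measurable M,
    forall w, U (S w) -> ~ Heavy k w -> M w & (P M <= (b ^+ k)%:E)%E].
Proof.
move=> Usmall; have /andP[t0 t1] := t01; have /andP[bb0 b1] := b01.
pose V x := ~~ heavy k x && `[< exists2 u, U u & `|u - signed_sum t x| <= c * rho ^+ k >].
exists [set w | V (word eps (n * k) w)]; split; first exact: measurable_word.
  move=> w Uw Hw; apply/andP; split; first exact/negP.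
  apply/asboolP; exists (S w) => //; rewrite /rho -exprM.
  by apply: dist_word => //; exact: ltW.
rewrite (prob_wordE eps_indep eps_p) lee_fin.
have [[x sx Vx]|noV] := pselect (exists2 x, size x = (n * k)%N & V x); last first.
  rewrite (@eq_word_mean _ _ _ _ (fun=> 0)) ?word_mean_cst ?exprn_ge0 ?ltW//.
  move=> x sx; case: (boolP (V x)) => // Vx.
  by exfalso; apply: noV; exists x.
have /andP[] := Vx; rewrite /heavy -leNgt => Hx /asboolP[u Uu ux].
apply: le_trans Hx; apply: le_word_mean => // y _.
case: (boolP (V y)) => //= /andP[_ /asboolP[v Uv vy]].
suff -> : `|signed_sum t x - signed_sum t y| <= (2 * c + 1) * rho ^+ k by [].
have -> : signed_sum t x - signed_sum t y = - (u - signed_sum t x) + ((u - v) + (v - signed_sum t y)) by ring.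
rewrite (le_trans (ler_normD _ _))// normrN.
have := ler_normD (u - v) (v - signed_sum t y); have := Usmall _ _ Uu Uv; lra.
Qed.

(** The scale [k] is chosen with [rho ^ (k + 1) < diam U <= rho ^ k]. A set of
    diameter zero has no such scale: it is a point, to which all scales apply,
    so its light part is null. *)
Lemma light_part_of_cover_set (U : set R) k0 (s1 : R) : 0 <= s1 -> s1 < s ->
  (diameter U <= (rho ^+ k0)%:E)%E ->
  exists M : set T, [/\ measurable M,
    forall w, U (S w) -> (forall k, (k0 <= k)%N -> ~ Heavy k w) -> M w &
    (P M <= b^-1%:E * hausdorff_weight s1 U)%E].
Proof.
move=> s10 s1s dU; have /andP[r0 r1] := rho01; have /andP[bb0 b1] := b01.
have dUx x y : U x -> U y -> (`|x - y|%:E <= diameter U)%E.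
  by move=> Ux Uy; apply: ereal_sup_ubound; exists (x, y).
rewrite /hausdorff_weight; case: eqP => [->|/eqP/set0P[u0 Uu0]].
  by exists set0; split => //; rewrite measure0 mule0.
have d0 : (0 <= diameter U)%E.
  by apply: le_trans (dUx _ _ Uu0 Uu0); rewrite lee_fin.
have [dd dE] : exists dd : R, diameter U = dd%:E.
  by move: d0 dU; case: (diameter U) => // r _ _; exists r.
rewrite dE !lee_fin in d0 dU; rewrite dE poweR_EFin -EFinM.
have {}dUx x y : U x -> U y -> `|x - y| <= dd.
  by move=> Ux Uy; rewrite -lee_fin -dE; exact: dUx.
move: d0; rewrite le_eqVlt => /predU1P[d0|d0].
  exists (S @^-1` [set u0] `&` ~` \bigcup_(k in [set k | (k0 <= k)%N]) Heavy k).
  have mM : measurable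
      (S @^-1` [set u0] `&` ~` \bigcup_(k in [set k | (k0 <= k)%N]) Heavy k).
    apply: measurableI; first exact: (measurable_funPTI S).
    by apply: measurableC; apply: bigcup_measurable => k _; exact: mHeavy.
  split => //.
    move=> w Uw Hw; split.
      apply/eqP; rewrite -subr_eq0 -normr_le0 d0; exact: dUx.
    by move=> [k /= kk]; exact: Hw.
  apply: (@le_trans _ _ 0%E); last first.
    by rewrite lee_fin mulr_ge0 ?powR_ge0// invr_ge0 ltW.
  have fP : P (S @^-1` [set u0] `&` ~` \bigcup_(k in [set k | (k0 <= k)%N]) Heavy k)
    \is a fin_num by exact: fin_num_measure.
  rewrite -(fineK fP) lee_fin leNgt; apply/negP => P0.
  have [m bm] : exists m, b ^+ m < fine (P (S @^-1` [set u0] `&` ~`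
      \bigcup_(k in [set k | (k0 <= k)%N]) Heavy k)).
    by apply: expr_small => //; rewrite b1 ltW.
  have [M [mM' MS PM]] : exists M : set T, [/\ measurable M,
      forall w, [set u0] (S w) -> ~ Heavy (maxn k0 m) w -> M w &
      (P M <= (b ^+ maxn k0 m)%:E)%E].
    apply: light_part_of_small_set => x y -> ->.
    by rewrite subrr normr0 exprn_ge0// ltW.
  have : (P (S @^-1` [set u0] `&` ~` \bigcup_(k in [set k | (k0 <= k)%N]) Heavy k)
      <= (b ^+ m)%:E)%E.
    apply: (le_trans (le_measure _ _ _ _)); [exact: mem_set mM|exact: mem_set mM'| |].
      move=> w [Sw Hw]; apply: MS => // Hk; apply: Hw.
      by exists (maxn k0 m) => //=; exact: leq_maxl.
    rewrite (le_trans PM)// lee_fin ler_iXn2l//; exact: leq_maxr.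
  by rewrite -(fineK fP) lee_fin leNgt bm.
have [m mP mmin] := ex_minnP (@expr_small _ rho dd (ltac:(by rewrite r1 ltW)) d0).
have km : (k0 < m)%N by rewrite -(ltr_iXn2l r0 r1) (lt_le_trans mP).
case: m km mP mmin => // k km mP mmin.
have dk : dd <= rho ^+ k.
  by rewrite leNgt; apply/negP => /mmin; rewrite ltnn.
have [M [mM MS PM]] := @light_part_of_small_set U k
  (fun x y Ux Uy => le_trans (dUx x y Ux Uy) dk).
exists M; split => //; first by move=> w Uw; move=> /(_ k km); exact: MS.
rewrite (le_trans PM)// lee_fin ler_pdivlMl// -exprS.
have dd1 : dd <= 1 by rewrite (le_trans dk)// exprn_ile1// ltW.
apply: (@le_trans _ _ (dd `^ s)); last by apply: ler_powR_anti => //; exact: ltW.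
rewrite /b -(powRX s k.+1 (ltW r0)) ge0_ler_powR ?nnegrE ?(ltW s0) ?(ltW d0) ?(ltW mP)//.
by rewrite exprn_ge0// ltW.
Qed.

(** Mass distribution principle. By Borel-Cantelli almost every outcome is
    eventually light, so some [k0] gives positive probability to the outcomes in
    the preimage of [B] which are light at all scales from [k0] on; a cover of
    [B] by sets of diameter at most [rho ^ k0] bounds this probability by a
    constant times the sum of its weights, which can be arbitrarily small if
    the Hausdorff measure vanishes. *)
Lemma hausdorff_dim_lower (B : set R) : measurable B ->
  (0 < P (S @^-1` B))%E -> (s%:E <= hausdorff_dim B)%E.
Proof.
move=> mB PB; have /andP[r0 r1] := rho01; have /andP[bb0 b1] := b01.
apply: le_ereal_inf_tmp => _ [s1 [s10 Hs1] <-]; rewrite lee_fin leNgt.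
apply/negP => s1s.
have mSB : measurable (S @^-1` B) by exact: (measurable_funPTI S).
pose Light k0 := ~` \bigcup_(k in [set k | (k0 <= k)%N]) Heavy k.
have mLight k : measurable (Light k).
  by apply: measurableC; apply: bigcup_measurable => *; exact: mHeavy.
have limHeavy : P (lim_sup_set Heavy) = 0%E.
  apply: lim_sup_set_cvg0 => //.
  apply: (@le_lt_trans _ _ ((1 / (1 - rho `^ (theta * (s' - s))))%:E)); last exact: ltry.
  apply: le_trans (@nneseries_geometric_le _ 1 (rho `^ (theta * (s' - s))) _ _) => //.
    apply: lee_nneseries => // k _.
    have PH : P (Heavy k) = _ := prob_wordE eps_indep eps_p (n * k) (heavy k).
    suff h : (P (Heavy k) <= (1 * rho `^ (theta * (s' - s)) ^+ k)%:E)%E by [].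
    by rewrite PH lee_fin mul1r heavy_prob.
  by rewrite powR_ge0 powR_lt1// mulr_gt0// subr_gt0.
have [k0 Pk0] : exists k0, (0 < P (S @^-1` B `&` Light k0))%E.
  apply: contrapT => /forallNP h.
  pose F i := if i is k.+1 then S @^-1` B `&` Light k else lim_sup_set Heavy.
  have mF i : measurable (F i).
    case: i => [|k]; last exact: measurableI.
    by apply: bigcap_measurableType => k _; apply: bigcup_measurable.
  have : (P (S @^-1` B) <= \sum_(0 <= i <oo) P (F i))%E.
    apply: measure_sigma_subadditive => // w Bw.
    have [Lw|/existsNP[k Hk]] := pselect (forall k,
        (\bigcup_(j in [set j | (k <= j)%N]) Heavy j) w).
      by exists 0%N => // k _; exact: Lw.
    exists k.+1 => //; split => //.
  rewrite eseries0; first by rewrite leNgt PB.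
  move=> [_ _|k _ _]; first exact: limHeavy.
  apply/eqP; rewrite eq_le measure_ge0 andbT leNgt; apply/negP; exact: h.
set E := S @^-1` B `&` Light k0 in Pk0.
have mE : measurable E by exact: measurableI.
have fE : P E \is a fin_num by exact: fin_num_measure.
have x0 : 0 < fine (P E) * b by rewrite mulr_gt0// -lte_fin fineK.
have : (hausdorff_content s1 (rho ^+ k0) B < (fine (P E) * b)%:E)%E.
  apply: (@le_lt_trans _ _ (hausdorff_measure s1 B)); last by rewrite Hs1 lte_fin.
  by apply: ereal_sup_ubound; exists (rho ^+ k0) => //=; exact: exprn_gt0.
move=> /ereal_inf_lt[_ [U [BU dU] <-] sumU].
have /choice[M MP] : forall i, exists M : set T, [/\ measurable M,
    forall w, U i (S w) -> (forall k, (k0 <= k)%N -> ~ Heavy k w) -> M w &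
    (P M <= b^-1%:E * hausdorff_weight s1 (U i))%E].
  by move=> i; exact: light_part_of_cover_set.
have w0 i : (0 <= hausdorff_weight s1 (U i))%E.
  by rewrite /hausdorff_weight; case: ifP => // _; exact: poweR_ge0.
have : (P E <= \sum_(0 <= i <oo) b^-1%:E * hausdorff_weight s1 (U i))%E.
  apply: (@le_trans _ _ (\sum_(0 <= i <oo) P (M i))%E).
    apply: measure_sigma_subadditive => //; first by move=> i; case: (MP i).
    move=> w [Bw Lw]; have [i _ Uw] := BU _ Bw.
    exists i => //; case: (MP i) => _ + _; apply => // k kk Hk.
    by apply: Lw; exists k.
  by apply: lee_nneseries => // i _; case: (MP i).
rewrite nneseriesZl//; apply/negP; rewrite -ltNge.
rewrite lte_pdivrMl// muleC.
by move: sumU; rewrite EFinM fineK.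
Qed.

End LowerBound.

(** * Upper bounds for Hausdorff measures *)

Section HausdorffUpper.
Variable R : realType.
Implicit Types (s e : R) (U A : set R).

Lemma hausdorff_weight_ge0 s U : (0 <= hausdorff_weight s U)%E.
Proof. by rewrite /hausdorff_weight; case: ifP => // _; exact: poweR_ge0. Qed.

Lemma hausdorff_weight_le s e U : 0 <= s ->
  (forall x y, U x -> U y -> `|x - y| <= e) ->
  (hausdorff_weight s U <= (e `^ s)%:E)%E.
Proof.
move=> s0 Ue; rewrite /hausdorff_weight; case: eqP => [_|/eqP/set0P[u Uu]].
  by rewrite lee_fin powR_ge0.
have d0 : (0 <= diameter U)%E.
  apply: (@le_trans _ _ (`|u - u|)%:E); first by rewrite lee_fin.
  by apply: ereal_sup_ubound; exists (u, u).
have dU : (diameter U <= e%:E)%E.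
  by apply: ge_ereal_sup => _ [[x y] [/= Ux Uy] <-]; rewrite lee_fin Ue.
move: d0 dU; case: (diameter U) => // d.
rewrite poweR_EFin => d0 de; rewrite !lee_fin in d0 de.
by rewrite lee_fin ge0_ler_powR// nnegrE// (le_trans d0).
Qed.

Lemma hausdorff_content_ge0 s e A : (0 <= hausdorff_content s e A)%E.
Proof.
apply: le_ereal_inf_tmp => _ [U _ <-]; apply: nneseries_ge0 => i _ _.
exact: hausdorff_weight_ge0.
Qed.

(** Covers are sequences, whereas limsup sets come with doubly indexed covers;
    a bijection between [nat * nat] and [nat] reconciles the two. *)
Lemma hausdorff_content_double s e A (U : nat -> nat -> set R) :
  A `<=` \bigcup_i \bigcup_j U i j ->
  (forall i j, (diameter (U i j) <= e%:E)%E) ->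
  (hausdorff_content s e A <=
   \sum_(0 <= i <oo) \sum_(0 <= j <oo) hausdorff_weight s (U i j))%E.
Proof.
move=> AU dU; have /card_esym/ppcard_eqP[f] := card_nat2.
pose V k := U (f k).1 (f k).2.
apply: (@le_trans _ _ (\sum_(0 <= k <oo) hausdorff_weight s (V k))%E).
  apply: ereal_inf_lbound; exists V => //; split => [x /AU[i _ [j _ Uij]]|k].
    by exists (f^-1%FUN (i, j)) => //=; rewrite /V invK ?inE.
  exact: dU.
have w0 i j : (0 <= hausdorff_weight s (U i j))%E by exact: hausdorff_weight_ge0.
rewrite nneseries_esumT//; last by move=> k; exact: w0.
rewrite -(@reindex_esum _ _ _ setT setT f
  (fun ij => hausdorff_weight s (U ij.1 ij.2)))//.
rewrite nneseries_esumT; last by move=> i; exact: nneseries_ge0.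
under [leRHS]eq_esum do rewrite nneseries_esumT//.
rewrite (@esum_esum _ _ _ setT (fun=> setT) (fun i j => hausdorff_weight s (U i j)))//.
by rewrite (_ : setT `*`` _ = setT)//; apply/seteqP; split.
Qed.

End HausdorffUpper.

(** * Crowded intervals are rare below the dimension *)

Section CrowdedCells.
Context (R : realType) (t p c K s s2 : R).
Hypotheses (t01 : 0 < t < 1) (p01 : 0 <= p <= 1) (c0 : 0 <= c)
  (tc : 1 + t * c <= c) (K0 : 0 < K) (s0 : 0 < s) (ss2 : s < s2).

(** The partial sum is shifted by [c] to become nonnegative, so that intervals
    of length [K * t ^ N] can be numbered by natural numbers. *)
Definition cell N (x : seq bool) : nat := Num.truncn ((signed_sum t x + c) / (K * t ^+ N)).

Definition cell_prob N i : R := word_mean p N (fun x => (cell N x == i)%:R).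

Definition crowded N x : bool := (t ^+ N) `^ s < cell_prob N (cell N x).

Let tN0 N : 0 < t ^+ N. Proof. by rewrite exprn_gt0//; case/andP: t01. Qed.

Let w0 N : 0 < K * t ^+ N. Proof. by rewrite mulr_gt0. Qed.

Lemma cell_itv N x : (cell N x)%:R * (K * t ^+ N) <= signed_sum t x + c <
  ((cell N x)%:R + 1) * (K * t ^+ N).
Proof.
have /andP[t0 _] := t01.
have p0 : 0 <= signed_sum t x + c.
  by rewrite -lerBlDr sub0r; have := signed_sum_bound x (ltW t0) tc c0; rewrite ler_norml => /andP[].
have /truncn_itv : 0 <= (signed_sum t x + c) / (K * t ^+ N) by rewrite divr_ge0// ltW.
by rewrite ler_pdivlMr// ltr_pdivrMr// natr1.
Qed.

(** A window of diameter at most one cell meets at most two cells. *)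
Lemma uncrowded_window N y r : 2 * r <= K * t ^+ N ->
  word_mean p N (fun x => (~~ crowded N x && (`|signed_sum t x - y| <= r)%R)%:R) <=
  2 * (t ^+ N) `^ s.
Proof.
move=> rK; set w := K * t ^+ N in rK; have ww0 : 0 < w by exact: w0.
pose i0 := Num.truncn ((y - r + c) / w).
have E1 i : word_mean p N (fun x => (~~ crowded N x && (cell N x == i))%:R) <=
    (t ^+ N) `^ s.
  have [h|h] := leP (cell_prob N i) ((t ^+ N) `^ s).
    apply: le_trans h; apply: le_word_mean => // x _.
    by case: (_ == i); rewrite ?andbF//; case: crowded.
  rewrite -[leRHS]addr0 -[X in _ <= X + _](word_mean_cst p N) addr0.
  apply: le_word_mean => // x _; case: eqP => [xi|_]; last by rewrite andbF powR_ge0.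
  by rewrite /crowded xi h /= powR_ge0.
have -> : 2 * (t ^+ N) `^ s = (t ^+ N) `^ s + (t ^+ N) `^ s by ring.
apply: le_trans (lerD (E1 i0) (E1 i0.+1)); rewrite -word_meanD.
apply: le_word_mean => // x _; case: (crowded N x) => /=; first by rewrite addr0.
have [h|_] := boolP (`|signed_sum t x - y| <= r); last by rewrite addr_ge0.
suff : (cell N x == i0) || (cell N x == i0.+1).
  by case/orP => ->; rewrite ?lerDl ?lerDr.
have /andP[x1 x2] := cell_itv N x; rewrite -/w in x1 x2.
have [y0|y0] := leP 0 ((y - r + c) / w); last first.
  move: h; rewrite ler_norml => /andP[_ h].
  have -> : i0 = 0%N by apply/truncn0Pn; rewrite -ltNge (lt_trans y0).
  have : (y - r + c) < 0 by rewrite -(pmulr_llt0 _ (_ : 0 < w^-1)) ?invr_gt0.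
  move=> yr; suff : (cell N x < 1)%N by case: (cell N x).
  by rewrite -(ltr_nat R) -(ltr_pM2r ww0) mul1r (le_lt_trans x1)//; lra.
have := truncn_itv y0; rewrite -/i0 ler_pdivlMr// ltr_pdivrMr// => /andP[y1 y2].
move: h; rewrite ler_norml => /andP[h1 h2].
have i1 : (cell N x < i0.+2)%N.
  rewrite -(ltr_nat R) -(ltr_pM2r ww0) (le_lt_trans x1)//.
  by move: y2; rewrite -(natr1 i0.+1) mulrDl; lra.
have i2 : (i0 < (cell N x).+1)%N.
  rewrite -(ltr_nat R) -(ltr_pM2r ww0) -natr1 (le_lt_trans _ x2)//; lra.
by move: i1 i2; rewrite !ltnS leq_eqVlt ltnS => /orP[->|i1 i2]; rewrite ?orbT// eqn_leq i1 i2.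
Qed.

(* The closed interval is a cell, shifted back by [c], enlarged by the
   distance [c * t ^ N] between the random sum and its partial sum. *)
Let crowd N i : set R :=
  if (t ^+ N) `^ s < cell_prob N i then
    `[i%:R * (K * t ^+ N) - c - c * t ^+ N,
      (i%:R + 1) * (K * t ^+ N) - c + c * t ^+ N]%classic
  else set0.

Let crowds N := \bigcup_i crowd N i.

Let mcrowds N : measurable (crowds N : set (measurableTypeR R)).
Proof.
by apply: bigcup_measurable => i _; rewrite /crowd; case: ifP.
Qed.

Let crowd_diam N i x y : crowd N i x -> crowd N i y ->
  `|x - y| <= (K + 2 * c) * t ^+ N.
Proof.
rewrite /crowd; case: ifP => // _ /=; rewrite !in_itv /= => /andP[x1 x2] /andP[y1 y2].
by rewrite ler_norml; apply/andP; split; lra.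
Qed.

Let cell_prob_sum N m : \sum_(0 <= i < m) cell_prob N i <= 1.
Proof.
rewrite -word_mean_sum; apply: word_mean_le1 => // x _.
rewrite -natr_sum lern1; elim: m => [|m IH]; first by rewrite big_nil.
have [mx|mx] := ltnP (cell N x) m.
  by rewrite big_nat_recr//= (ltn_eqF mx) addn0.
rewrite big_nat_recr//= big_nat_cond big1 ?add0n ?leq_b1// => i /andP[/andP[_ im] _].
by rewrite eqn_leq leqNgt (leq_trans im mx).
Qed.

Let q : R := t `^ (s2 - s).

(** There are at most [(t ^ N) ^ - s] crowded cells, as the probabilities of the
    cells add up to at most one; each has weight of order [t ^ (N * s2)]. *)
Lemma crowd_weight N :
  (\sum_(0 <= i <oo) hausdorff_weight s2 (crowd N i) <=
   ((K + 2 * c) `^ s2 * q ^+ N)%:E)%E.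
Proof.
have /andP[t0 t1] := t01.
have s20 : 0 < s2 by exact: lt_trans ss2.
have kap0 : 0 <= K + 2 * c by rewrite addr_ge0 ?mulr_ge0// ltW.
have ts0 : 0 < (t ^+ N) `^ s by rewrite powR_gt0.
set a := ((K + 2 * c) * t ^+ N) `^ s2 / (t ^+ N) `^ s.
have aE : a = (K + 2 * c) `^ s2 * q ^+ N.
  rewrite /a powRM ?(ltW (tN0 N))// -mulrA; congr (_ * _).
  rewrite /q -(powRX (s2 - s) N (ltW t0)) powRB ?gt_eqF ?implybT//.
apply: (@le_trans _ _ (\sum_(0 <= i <oo) (a%:E * (cell_prob N i)%:E))%E).
  apply: lee_nneseries => i _; first by rewrite hausdorff_weight_ge0.
  have [h|h] := ltP ((t ^+ N) `^ s) (cell_prob N i); last first.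
    rewrite /crowd ltNge h /= /hausdorff_weight eqxx -EFinM lee_fin mulr_ge0//.
      by rewrite divr_ge0// powR_ge0.
    exact: word_mean_ge0.
  apply: le_trans (hausdorff_weight_le (ltW s20) (@crowd_diam N i)) _.
  rewrite -EFinM lee_fin /a mulrAC -mulrA ler_peMr ?powR_ge0//.
  by rewrite ler_pdivlMr// mul1r ltW.
rewrite nneseriesZl; last by move=> i _; rewrite lee_fin; exact: word_mean_ge0.
have a0 : 0 <= a by rewrite divr_ge0// powR_ge0.
rewrite -aE -[leRHS]mule1 lee_wpmul2l//.
apply: lime_le; first by apply: is_cvg_nneseries => i _ _; rewrite lee_fin word_mean_ge0.
by apply: nearW => m; rewrite sumEFin lee_fin.
Qed.

(** The crowded intervals at all scales from [M] on cover the limsup set, and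
    the sum of their weights is the tail of a geometric series. *)
Lemma hausdorff_measure_limsup_crowds : hausdorff_measure s2 (lim_sup_set crowds) = 0%E.
Proof.
have /andP[t0 t1] := t01.
have q01 : 0 <= q < 1 by rewrite powR_ge0 powR_lt1// subr_gt0.
have /andP[q0 q1] := q01.
have kap0 : 0 < K + 2 * c by rewrite ltr_wpDr ?mulr_ge0.
set C := (K + 2 * c) `^ s2; have C0 : 0 < C by rewrite powR_gt0.
apply/eqP; rewrite eq_le; apply/andP; split; last first.
  apply: le_trans (hausdorff_content_ge0 s2 1 _) _.
  by apply: ereal_sup_ubound; exists 1 => //=; exact: ltr01.
apply: ge_ereal_sup => _ [delta /= delta0 <-].
apply/lee_addgt0Pr => e e0; rewrite add0e.
have [m1 hm1] := @expr_small _ t (delta / (K + 2 * c)) (ltac:(by rewrite t1 ltW))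
  (divr_gt0 delta0 kap0).
have e'0 : 0 < e * (1 - q) / C by rewrite divr_gt0// mulr_gt0// subr_gt0.
have [m2 hm2] := expr_small q01 e'0.
pose M := maxn m1 m2.
have tM : (K + 2 * c) * t ^+ M <= delta.
  rewrite -ler_pdivlMl// mulrC (le_trans _ (ltW hm1))// ler_iXn2l//; exact: leq_maxl.
have qM : q ^+ M <= e * (1 - q) / C.
  rewrite (le_trans _ (ltW hm2))// ler_wiXn2l ?(ltW q1)//; exact: leq_maxr.
apply: (le_trans (@hausdorff_content_double _ s2 delta _ (fun i => crowd (M + i)) _ _)).
- move=> x /(_ M I)[N /= MN [j _ Nj]]; exists (N - M)%N => //.
  by exists j => //; rewrite subnKC.
- move=> i j; apply: ge_ereal_sup => _ [[x y] [/= Ux Uy] <-]; rewrite lee_fin.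
  rewrite (le_trans (crowd_diam Ux Uy))// (le_trans _ tM)// ler_wpM2l ?(ltW kap0)//.
  by rewrite ler_iXn2l// leq_addr.
apply: (@le_trans _ _ (\sum_(0 <= i <oo) ((C * q ^+ M) * q ^+ i)%:E)%E).
  apply: lee_nneseries => i _ *.
    by apply: nneseries_ge0 => *; exact: hausdorff_weight_ge0.
  by rewrite (le_trans (crowd_weight (M + i)))// exprD mulrA.
apply: (le_trans (nneseries_geometric_le _ q01)).
  by rewrite mulr_ge0 ?exprn_ge0// ltW.
rewrite lee_fin ler_pdivrMr ?subr_gt0//.
by rewrite -ler_pdivlMl// [leRHS]mulrC.
Qed.

Context (d : measure_display) (T : measurableType d)
  (P : probability T R) (eps : nat -> {RV P >-> bool})
  (S : {RV P >-> measurableTypeR R})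
  (nu : probability (measurableTypeR R) R).
Hypothesis eps_indep : mutually_independent eps.
Hypothesis eps_p : forall n, P (eps n @^-1` [set true]) = p%:E.
Hypothesis cvgS :
  forall w, series (fun n => (-1) ^+ (~~ eps n w) * t ^+ n) @ \oo --> S w.
Hypothesis nuS : forall B, measurable B -> nu B = distribution P S B.
Hypothesis dim_nu : (s2%:E < lower_hausdorff_dim nu)%E.

(** The limsup set of the crowded intervals has dimension at most [s2], hence
    measure zero; by continuity from above so do, in the limit, the unions of
    the crowded intervals over large scales. *)
Lemma crowded_rare (e : R) : 0 < e -> exists M, forall N, (M <= N)%N ->
  word_mean p N (fun x => (crowded N x)%:R) <= e.
Proof.
move=> e0; have /andP[t0 t1] := t01.
have mL : measurable (lim_sup_set crowds : set (measurableTypeR R)).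
  by apply: bigcap_measurableType => k _; apply: bigcup_measurable.
have nuL : nu (lim_sup_set crowds) = 0%E.
  apply/eqP; rewrite eq_le measure_ge0 andbT leNgt; apply/negP => nuL.
  have : (lower_hausdorff_dim nu <= s2%:E)%E.
    apply: (@le_trans _ _ (hausdorff_dim (lim_sup_set crowds))).
      by apply: ereal_inf_lbound; exists (lim_sup_set crowds).
    apply: ereal_inf_lbound; exists s2 => //; split.
      by rewrite ltW// (lt_trans s0).
    exact: hausdorff_measure_limsup_crowds.
  by rewrite leNgt dim_nu.
have [M hM] : exists M,
    (nu (\bigcup_(k in [set k | (M <= k)%N]) crowds k) < e%:E)%E.
  apply: contrapT => /forallNP h.
  have fin : (nu (\bigcup_(k in [set k | (0 <= k)%N]) crowds k) < +oo)%E.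
    rewrite (le_lt_trans _ (ltry 1))// probability_le1//.
    exact: bigcup_measurable.
  have cv : (fun n => nu (\bigcup_(k in [set k | (n <= k)%N]) crowds k)) @ \oo -->
      nu (lim_sup_set crowds) := lim_sup_set_cvg nu _ mcrowds fin.
  have : (e%:E <= nu (lim_sup_set crowds))%E.
    apply: (@cvge_to_ge _ _ _ _ _ _ _ cv); apply: nearW => M.
    by rewrite leNgt; exact/negP.
  by rewrite nuL lee_fin leNgt e0.
exists M => N MN; rewrite -lee_fin -(prob_wordE eps_indep eps_p).
apply: le_trans (ltW hM); apply: (@le_trans _ _ (nu (crowds N))); last first.
  apply: le_measure; rewrite ?inE//; first exact: bigcup_measurable.
  by move=> x cx; exists N.
rewrite nuS// /distribution /pushforward.
apply: le_measure; rewrite ?inE; [exact: measurable_word|exact: (measurable_funPTI S)|].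
move=> w /= cw; exists (cell N (word eps N w)) => //.
rewrite /crowd [X in if X then _ else _]cw /= in_itv /=.
have := dist_word (ltW t0) cvgS N w c0 tc; rewrite ler_norml => /andP[h1 h2].
have /andP[h3 h4] := cell_itv N (word eps N w).
by apply/andP; split; lra.
Qed.

End CrowdedCells.

(** * Choice of the parameters and stability *)

Section Assembly.
Variable R : realType.

(** Both sides equal [1] at [theta = 0], and the hypothesis says that the left one
    has the smaller derivative there. *)
Lemma small_exponent (eta eps B : R) : 0 < eta -> 0 <= eps < 1 -> 0 <= B ->
  B + 1 < (1 - eps) * - ln eta ->
  exists2 theta, 0 < theta <= 1 &
    eta `^ theta * (1 - eps + theta) + eps <= expR (- (theta * B)).
Proof.
move=> eta0 /andP[eps0 eps1]; set H := - ln eta => B0 HB.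
have eps'0 : 0 < 1 - eps by rewrite subr_gt0.
have H0 : 0 < H by rewrite -(pmulr_rgt0 _ eps'0) (lt_trans _ HB)// ltr_wpDl.
have B10 : 0 < B + 1 by rewrite ltr_wpDl.
pose th := Num.min 1 (((1 - eps) * H - (B + 1)) / (H * (B + 1))).
have th0 : 0 < th.
  by rewrite /th lt_min ltr01 /= divr_gt0 ?mulr_gt0// subr_gt0.
have thle : th * (H * (B + 1)) <= (1 - eps) * H - (B + 1).
  by rewrite -ler_pdivlMr ?mulr_gt0// /th ge_min lexx orbT.
exists th; first by rewrite th0 /th ge_min lexx.
apply: le_trans (expR_ge1Dx _).
have -> : eta `^ th = expR (- (th * H)).
  by rewrite /powR gt_eqF// /H mulrN opprK.
set x := th * H; have x0 : 0 < x by rewrite mulr_gt0.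
have E0 : 0 < expR (- x) by exact: expR_gt0.
have E1 : expR (- x) * (1 + x) <= 1.
  have E2 : expR (- x) * expR x = 1 by rewrite -expRD addNr expR0.
  by rewrite -[leRHS]E2 ler_pM2l// expR_ge1Dx.
set E := expR (- x) in E0 E1 *.
have h1 : th * (B + 1) * (1 + x) <= (1 - eps) * x.
  have := ler_wpM2l (ltW th0) thle; rewrite /x; lra.
(* [E1] bounds [E] by [1 / (1 + x)]; multiplying by [1 + x] avoids the fraction. *)
rewrite -(ler_pM2r (_ : 0 < 1 + x)) ?addr_gt0//.
have h2 := ler_wpM2r (_ : 0 <= 1 - eps + th) E1.
have : 0 <= 1 - eps + th by rewrite addr_ge0// ltW.
move=> /h2; have : 0 <= th * x by rewrite mulr_ge0// ltW.
lra.
Qed.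

Lemma ball_moment (t p c : R) n theta A : 0 <= p <= 1 -> 0 < t < 1 ->
  0 <= c -> 1 + t * c <= c -> 0 < theta -> 0 <= A ->
  (forall L, nonneg_weights L ->
    word_mean p n (fun w => mass L (signed_sum t w) ((3 * c + 1) * t ^+ n) `^ theta) <=
    total L `^ theta * A) ->
  forall k, word_mean p (n * k) (fun x => ball_prob t p c n k x `^ theta) <= A ^+ k.
Proof.
move=> p01 t01 c0 tc th0 A0 HA k.
have [L [L0 LE]] := word_mean_list (n * k) p01.
pose L' := [seq (x.1, signed_sum t x.2) | x <- L].
have L'0 : nonneg_weights L' by move=> x /mapP[y /L0 y0 ->].
have tot1 : total L' = 1.
  rewrite /total big_map -[RHS](word_mean_cst p (n * k)) LE.
  by apply: eq_bigr => x _; rewrite mulr1.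
have := multi_scale_moment p01 t01 c0 tc th0 A0 HA k L'0.
rewrite tot1 powR1 mul1r mulnC; congr (_ <= _); apply: eq_word_mean => x _.
congr (_ `^ _); rewrite /mass /ball_prob big_map LE exprM.
by apply: eq_bigr.
Qed.

Lemma dimension_lower_bound (t p c : R) (nu : probability (measurableTypeR R) R)
    n theta A s' s :
  0 < t < 1 -> 0 <= p <= 1 -> 0 <= c -> 1 + t * c <= c -> (0 < n)%N ->
  0 < theta -> 0 <= A ->
  (forall L, nonneg_weights L ->
    word_mean p n (fun w => mass L (signed_sum t w) ((3 * c + 1) * t ^+ n) `^ theta) <=
    total L `^ theta * A) ->
  A <= (t ^+ n) `^ (theta * s') -> 0 < s -> s < s' ->
  is_biased_bernoulli_convolution t p nu ->
  (s%:E <= lower_hausdorff_dim nu)%E.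
Proof.
move=> t01 p01 c0 tc n0 th0 A0 HA As s0 ss' [d [T [P [eps [S [ind epsp cv nuS]]]]]].
apply: le_ereal_inf_tmp => _ [B [mB nuB] <-].
have mom := ball_moment p01 t01 c0 tc th0 A0 HA.
apply: (hausdorff_dim_lower t01 p01 c0 tc n0 th0 A0 mom As s0 ss' ind epsp cv mB).
by have := nuB; rewrite nuS.
Qed.

(** Apart from bounded terms both sides are proportional to [N], with slopes
    [s' * - ln t1] and [(1 - e) * s * - ln t0]. As [s' < s], there is room to take
    [e > 0] and [t1 < t0]; the number [t1] will bound from below the values of [t]
    near [t0]. The witnesses split the gap [s - s' = 4 h]: the left
    slope becomes [(s' + h) * - ln t0] and the right one
    [(s' + 2 h) * - ln t0]. *)
Lemma block_parameters (t0 s s' : R) : 0 < t0 < 1 -> 0 < s' -> s' < s ->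
  exists e t1 : R, [/\ 0 < e < 1, 0 < t1 < t0 &
    forall M, exists N, [/\ (M <= N)%N, (0 < N)%N &
      s' * (N%:R * - ln t1) + 1 < (1 - e) * - ln (3 * (t0 ^+ N) `^ s)]].
Proof.
move=> /andP[t00 t01] s'0 ss'; have s0 : 0 < s by exact: lt_trans ss'.
pose h := (s - s') / 4; have h0 : 0 < h by rewrite divr_gt0// subr_gt0.
have sE : s = s' + 4 * h by rewrite /h; field.
pose kap := h / s'; have kap0 : 0 < kap by rewrite divr_gt0.
pose L0 := - ln t0; have L00 : 0 < L0 by rewrite oppr_gt0 ln_lt0// t00.
have t10 : 0 < t0 `^ (1 + kap) by rewrite powR_gt0.
have lnt1 : - ln (t0 `^ (1 + kap)) = (1 + kap) * L0 by rewrite ln_powR mulrN.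
exists (2 * h / s), (t0 `^ (1 + kap)); split.
- apply/andP; split; first by rewrite divr_gt0// mulr_gt0.
  by rewrite ltr_pdivrMr// mul1r; lra.
- rewrite t10 /= -ltr_ln ?posrE// -ltrN2 lnt1 -/L0 mulrDl mul1r ltrDl mulr_gt0//.
move=> M; pose N := maxn (maxn M 1) (Num.truncn ((1 + ln 3) / (h * L0))).+1.
exists N; split; [by rewrite /N !leq_max leqnn|by rewrite /N !leq_max /= orbT|].
have NL : 1 + ln 3 < N%:R * (h * L0).
  rewrite -(ltr_pdivrMr _ _ (mulr_gt0 h0 L00)).
  apply: (lt_le_trans (truncnS_gt ((1 + ln 3) / (h * L0)))).
  by rewrite ler_nat /N leq_max leqnn orbT.
have ln3 : 0 <= ln 3 :> R by rewrite ln_ge0// ler1n.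
rewrite lnt1 lnM ?posrE ?powR_gt0 ?exprn_gt0// ln_powR lnXn// -[ln t0 *+ N]mulr_natl.
have -> : - (ln 3 + s * (N%:R * ln t0)) = N%:R * s * L0 - ln 3.
  by rewrite /L0; ring.
have es : (1 - 2 * h / s) * s = s' + 2 * h by rewrite sE; field; rewrite -sE gt_eqF.
have ks : s' * (1 + kap) = s' + h by rewrite /kap; field; rewrite gt_eqF.
have -> : s' * (N%:R * ((1 + kap) * L0)) = N%:R * L0 * (s' * (1 + kap)) by ring.
have -> : (1 - 2 * h / s) * (N%:R * s * L0 - ln 3) =
  N%:R * L0 * ((1 - 2 * h / s) * s) - (1 - 2 * h / s) * ln 3 by ring.
rewrite es ks.
have : (1 - 2 * h / s) * ln 3 <= ln 3.
  by rewrite ler_piMl// lerBlDr lerDl ltW// divr_gt0// mulr_gt0.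
move: NL; clear; lra.
Qed.

(** For [t] near [t0] a window of radius [(3 c + 1) t ^ N] around a partial sum
    at [t] is contained in a window of twice the radius at [t0], and for [p] near
    [p0] the probabilities of all sets of words of length [N] change by at most
    [eta] and [e / 2]. *)
Lemma good_words_stable (t0 p0 c eta e : R) N (G : pred (seq bool)) :
  0 < t0 < 1 -> 0 <= p0 <= 1 -> 0 <= c -> (0 < N)%N -> 0 < eta -> 0 < e ->
  (forall y, word_mean p0 N (fun x =>
    (G x && (`|signed_sum t0 x - y| <= 2 * (3 * c + 1) * t0 ^+ N)%R)%:R) <= 2 * eta) ->
  word_mean p0 N (fun x => (~~ G x)%:R) <= e / 2 ->
  exists2 delta : R, 0 < delta & forall t p : R, 0 < t < 1 -> 0 <= p <= 1 ->
    `|t - t0| < delta -> `|p - p0| < delta ->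
    (forall y, word_mean p N (fun x =>
      (G x && (`|signed_sum t x - y| <= (3 * c + 1) * t ^+ N)%R)%:R) <= 3 * eta) /\
    word_mean p N (fun x => (~~ G x)%:R) <= e.
Proof.
move=> /andP[t00 t01] p01 c0 N0 eta0 e0 HG HE.
have C1 : 1 <= 3 * c + 1 by rewrite lerDr mulr_ge0.
have C0 : 0 <= 3 * c + 1 by exact: le_trans C1.
have N0R : 0 < N%:R :> R by rewrite ltr0n.
have rho0 : 0 < t0 ^+ N by rewrite exprn_gt0.
pose D : R := (N ^ 2)%:R + (3 * c + 1) * N%:R + 1.
have D0 : 0 < D by rewrite ltr_wpDl// addr_ge0// mulr_ge0.
exists (Num.min (t0 ^+ N / D) (Num.min (eta / N%:R) (e / 2 / N%:R))).
  by rewrite !lt_min !divr_gt0.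
move=> t p /andP[tt0 tt1] pp01; rewrite !lt_min.
move=> /andP[dt _] /andP[_ /andP[dp1 dp2]].
have t01' : 0 <= t <= 1 by rewrite !ltW.
have t001 : 0 <= t0 <= 1 by rewrite !ltW.
have DP : `|t - t0| * D <= t0 ^+ N by rewrite -ler_pdivlMr// ltW.
have etaP : N%:R * `|p - p0| <= eta by rewrite mulrC -ler_pdivlMr// ltW.
have eP : N%:R * `|p - p0| <= e / 2 by rewrite mulrC -ler_pdivlMr// ltW.
split=> [y|].
  pose f x : R := (G x && (`|signed_sum t0 x - y| <= 2 * (3 * c + 1) * t0 ^+ N)%R)%:R.
  apply: (@le_trans _ _ (word_mean p N f)).
    apply: le_word_mean => // x sx; rewrite /f; case: (G x) => //=.
    have [hx|_] := boolP (`|signed_sum t x - y| <= _); last by [].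
    suff -> : `|signed_sum t0 x - y| <= 2 * (3 * c + 1) * t0 ^+ N by [].
    have -> : signed_sum t0 x - y = (signed_sum t x - y) - (signed_sum t x - signed_sum t0 x) by ring.
    rewrite (le_trans (ler_normB _ _))//.
    have := signed_sum_lip x t01' t001; rewrite sx => lip1.
    have := expr_lip N t01' t001; rewrite ler_norml => /andP[_ lip2].
    have lip3 := ler_wpM2l C0 lip2.
    have rhoC : t0 ^+ N <= (3 * c + 1) * t0 ^+ N by rewrite ler_peMl// ltW.
    have n0 : 0 <= `|t - t0| by [].
    move: DP hx lip1 lip3 rhoC n0; rewrite /D; clear; lra.
  have f01 x : 0 <= f x <= 1 by rewrite /f ler0n lern1 leq_b1.
  have := word_mean_lip N pp01 p01 f01; rewrite ler_norml => /andP[_ h1].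
  by have h2 := HG y; rewrite -/f in h2; move: h1 h2 etaP; clear; lra.
have f01 x : 0 <= ((~~ G x)%:R : R) <= 1 by rewrite ler0n lern1 leq_b1.
have := word_mean_lip N pp01 p01 f01; rewrite ler_norml => /andP[_ h1].
by move: h1 HE eP; clear; lra.
Qed.

(** Exponents are spaced evenly in [a < a + h < s' < s < a + 4 h], the last being
    below the dimension at [(t0, p0)], to absorb the losses of the successive steps: from the
    dimension to spread words, from there to the moment bound uniformly in [t],
    and from the moment bound to the dimension. *)
Lemma lower_dim_stable (t0 p0 a : R) (nu0 : probability (measurableTypeR R) R) :
  0 < t0 < 1 -> 0 < p0 < 1 -> is_biased_bernoulli_convolution t0 p0 nu0 ->
  0 <= a -> (a%:E < lower_hausdorff_dim nu0)%E ->
  exists2 delta : R, 0 < delta & forall (t p : R) (nu : probability (measurableTypeR R) R),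
    0 < t < 1 -> 0 < p < 1 -> `|t - t0| < delta -> `|p - p0| < delta ->
    is_biased_bernoulli_convolution t p nu -> (a%:E < lower_hausdorff_dim nu)%E.
Proof.
have in01 (x : R) : 0 < x < 1 -> 0 <= x <= 1 by move=> /andP[? ?]; rewrite !ltW.
move=> t01 /in01 p01 [d [T [P [eps [S [ind epsp cv nuS]]]]]] a0 adim.
have /andP[t00 t01'] := t01.
have [h h0 hdim] : exists2 h : R, 0 < h & ((a + 4 * h)%:E < lower_hausdorff_dim nu0)%E.
  move: adim; case: (lower_hausdorff_dim nu0) => [r| |//].
    rewrite lte_fin => ar; exists ((r - a) / 5); first by rewrite divr_gt0 ?subr_gt0.
    by rewrite lte_fin; lra.
  by move=> _; exists 1 => //; exact: ltry.
pose s := a + 3 * h; pose s' := a + 2 * h.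
have [s'0 s's ss2] : [/\ 0 < s', s' < s & s < a + 4 * h] by rewrite /s /s'; split; lra.
have s0 : 0 < s by exact: lt_trans s's.
have [as0 ass' aah] : [/\ 0 < a + h, a + h < s' & a < a + h].
  by rewrite /s'; split; lra.
(* [t2] bounds the values of [t] from above, which makes [c] uniform. *)
pose t2 := (1 + t0) / 2; pose c := (1 - t2)^-1.
have [t2c t0t2] : t2 < 1 /\ t0 < t2 by rewrite /t2; split; lra.
have c0 : 0 < c by rewrite invr_gt0 subr_gt0.
have tcP t : t <= t2 -> 1 + t * c <= c.
  move=> tt2; have : t * c <= t2 * c by rewrite ler_pM2r.
  have : (1 - t2) * c = 1 by rewrite mulfV// gt_eqF// subr_gt0.
  by clear; lra.
have [e [t1 [/andP[e0 e1] /andP[t10 t1t0] block]]] := block_parameters t01 s'0 s's.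
(* A window of radius [2 (3 c + 1) t0 ^ N] then has the length of one cell. *)
pose K := 4 * (3 * c + 1).
have K0 : 0 < K by rewrite mulr_gt0// addr_gt0 ?mulr_gt0.
have e20 : 0 < e / 2 by rewrite divr_gt0.
have [M HM] := crowded_rare t01 p01 (ltW c0) (tcP t0 (ltW t0t2)) K0 s0 ss2
  ind epsp cv nuS hdim e20.
have [N [MN N0 HB]] := block M.
have rho0 : 0 < (t0 ^+ N) `^ s by rewrite powR_gt0// exprn_gt0.
set eta := 3 * _ in HB.
have eta0 : 0 < eta by rewrite mulr_gt0.
set B := s' * _ in HB.
have B0 : 0 <= B.
  rewrite !mulr_ge0 ?(ltW s'0)// oppr_ge0 ln_le0//.
  by rewrite ltW// (lt_trans t1t0).
have [theta /andP[th0 th1] Hth] := small_exponent eta0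
  (introT andP (conj (ltW e0) e1)) B0 HB.
have eta1 : eta <= 1.
  rewrite -ler_ln ?posrE// ln1 -oppr_ge0 ltW//.
  have e'0 : 0 < 1 - e by rewrite subr_gt0.
  by rewrite -(pmulr_rgt0 _ e'0) (lt_trans _ HB)// ltr_wpDl.
set A := eta `^ theta * (1 - e + theta) + e in Hth.
have A0 : 0 <= A.
  have e'0 : 0 <= 1 - e + theta by rewrite addr_ge0 ?subr_ge0 ?(ltW e1) ?(ltW th0).
  by rewrite addr_ge0 ?(ltW e0)// mulr_ge0// powR_ge0.
pose G x := ~~ crowded t0 p0 c K s N x.
have [||delta delta0 HGE] := @good_words_stable t0 p0 c ((t0 ^+ N) `^ s) e N G
  t01 p01 (ltW c0) N0 rho0 e0.
- move=> y; apply: (@uncrowded_window _ t0 p0 c K s t01 p01 (ltW c0)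
    (tcP t0 (ltW t0t2)) K0 N y (2 * (3 * c + 1) * t0 ^+ N)).
  by rewrite /K le_eqVlt; apply/orP; left; apply/eqP; ring.
- rewrite (le_trans _ (HM N MN))// le_word_mean// => x _.
  by rewrite /G negbK.
exists (Num.min (Num.min (t0 - t1) (t2 - t0)) delta).
  by rewrite !lt_min !subr_gt0 t1t0 t0t2.
move=> t p nu tt01 /in01 pp01; rewrite !lt_min.
move=> /andP[/andP[dt1 dt2] dt] /andP[_ dp] bbc.
have t1t : t1 < t by move: dt1; rewrite ltr_norml => /andP[+ _]; clear; lra.
have tt2 : t <= t2 by move: dt2; rewrite ltr_norml => /andP[_]; clear; lra.
have /andP[tt0 tt1] := tt01.
have [HG HE] := HGE t p tt01 pp01 dt dp.
have HA := one_scale_moment pp01 (introT andP (conj th0 th1))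
  (introT andP (conj eta0 eta1)) HG HE.
have As : A <= (t ^+ N) `^ (theta * s').
  rewrite (le_trans Hth)// /powR gt_eqF ?exprn_gt0// ler_expR lnXn// -mulr_natl.
  have X0 : 0 <= theta * s' * N%:R by rewrite !mulr_ge0 ?(ltW th0) ?(ltW s'0).
  have : ln t1 <= ln t by rewrite ler_ln ?posrE// ltW.
  by move=> /(ler_wpM2l X0); rewrite /B; clear; lra.
apply: (@lt_le_trans _ _ (a + h)%:E); first by rewrite lte_fin.
exact: (dimension_lower_bound tt01 pp01 (ltW c0) (tcP t tt2) N0 th0 A0 HA As as0 ass' bbc).
Qed.

Lemma lower_hausdorff_dim_ge0 (nu : probability (measurableTypeR R) R) :
  (0 <= lower_hausdorff_dim nu)%E.
Proof.
apply: le_ereal_inf_tmp => _ [B _ <-]; apply: le_ereal_inf_tmp => _ [s [s0 _] <-].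
by rewrite lee_fin.
Qed.

End Assembly.

Theorem theorem1p8 (R : realType)
    (nu : R -> R -> probability (measurableTypeR R) R)
    (nuP : forall t p : R, 0 < t < 1 -> 0 < p < 1 ->
             is_biased_bernoulli_convolution t p (nu t p)) :
  lower_semicontinuous
    ((fun tp : R * R => lower_hausdorff_dim (nu tp.1 tp.2)) :
       subspace (`]0, 1[ `*` `]0, 1[ : set (R * R)) -> \bar R).
Proof.
move=> x a; case: (nbhs_subspaceP (`]0, 1[ `*` `]0, 1[ : set (R * R)) x).
  move=> [] /=; rewrite !in_itv /= => t01 p01 adim.
  (* A negative [a] is below every dimension. *)
  have [a0|a0] := ltP a 0.
    exists setT; first exact: filterT.
    by move=> y _; apply: lt_le_trans (lower_hausdorff_dim_ge0 _); rewrite lte_fin.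
  have [delta delta0 H] := lower_dim_stable t01 p01 (nuP _ _ t01 p01) a0 adim.
  exists [set y : R * R | (`]0, 1[ `*` `]0, 1[) y /\
      (`|y.1 - x.1| < delta /\ `|y.2 - x.2| < delta)].
    rewrite /within /=; apply: filterS (nbhsx_ballx (x : R * R) delta delta0).
    by move=> y [xy1 xy2] Ay; split => //; split; rewrite distrC.
  move=> [t p] [[/=]]; rewrite !in_itv /= => tt01 pp01 [tx px].
  by apply: (H t p) => //; exact: nuP.
(* Outside the square the points of the subspace are isolated. *)
move=> _ adim; exists [set x] => //.
by move=> y ->.
Qed.
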